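(* For each positive integer $n$, place $n$ queens at random on the $n\times n$ chessboard, let $S_n$ be the number of safe spaces and let $\mu_n=\mathbb{E}[S_n]/n^2$ be the expected proportion of safe spaces. Then, as $n\to\infty$, $\mathbb{E}[S_n]$ is asymptotic to $2n^2/e^4$, and $\mu_n$ converges to $2/e^4$.
   Context: The $n\times n$ board is the set of spaces $\{1,\dots,n\}^2$. ''Placing $n$ pieces at random'' means that the set of occupied spaces (the board configuration) is chosen uniformly among all $\binom{n^2}{n}$ subsets of $n$ distinct spaces. A queen at $(i,j)$ attacks every space $(x,y)$ on the board with $x=i$, or $y=j$, or $|x-i|=|y-j|$ (row, column and the two diagonals through $(i,j)$). A space is safe under a board configuration if it is neither occupied nor attacked by any of the placed pieces. *)

(* Defs.v *)
From HB Require Import structures.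
From mathcomp Require Import all_boot all_order all_algebra.
From mathcomp Require Import all_classical all_reals all_analysis.
Set Implicit Arguments.
Unset Strict Implicit.
Unset Printing Implicit Defensive.
Import Order.TTheory GRing.Theory Num.Theory.
Import numFieldNormedType.Exports.
Local Open Scope ring_scope.

(* Rows and columns are numbered from 0. *)
Definition space (n : nat) : finType := ('I_n * 'I_n)%type.

(* The absolute values are distances between naturals: the difference is taken
   in int, not truncated. *)
Definition queen_attacks (n : nat) (q s : space n) : bool :=
  [|| s.1 == q.1, s.2 == q.2 | (`|s.1 - q.1| == `|s.2 - q.2|)%N].

Definition configurations (n : nat) : {set {set space n}} :=
  [set B : {set space n} | #|B| == n].

Definition safe_spaces (n : nat) (B : {set space n}) : {set space n} :=
  [set s : space n | (s \notin B) && [forall q in B, ~~ queen_attacks q s]].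

Definition uniform_expectation (R : realType) (T : finType) (D : {set T})
    (X : T -> R) : R :=
  (\sum_(w in D) X w) / #|D|%:R.

Definition expected_safe (R : realType) (n : nat) : R :=
  uniform_expectation (configurations n) (fun B => #|safe_spaces B|%:R).

Definition mean_safe_proportion (R : realType) (n : nat) : R :=
  expected_safe R n / n%:R ^+ 2.

(* Main.v *)
(** A queen attacks symmetrically, so a space [s] is safe iff the [n] queens avoid
the set of spaces attacking [s], itself included. If [s] lies at distance [d] from
the edge of the board, this set has [3n - 2 + 2d] elements, and the probability of
avoiding it is [e^(-3 - 2d/n)] up to a factor [1 + O(1/n)], uniformly in [s].
Exactly [(n - 2d)^2] spaces are at distance at least [d] from the edge, so with
[u = 2d/n] the average of [e^(-2d/n)] is a Riemann sum for the integral of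
[2 (1 - u) e^(-u)] over [[0, 1]], which is [2/e]; since [(1 - u) e^(-u)] is
decreasing, its sums compare termwise with the increments of the primitive
[u e^(-u)]. *)

Require Import Defs.
From mathcomp Require Import all_boot all_order all_algebra.
From mathcomp Require Import all_classical all_reals all_analysis.
From mathcomp Require Import zify ring lra.
Import Order.TTheory GRing.Theory Num.Theory.
Import numFieldNormedType.Exports.
Local Open Scope ring_scope.

(** * Counting the attackers of a space and the spaces far from the edge *)

Definition edge_distance {n : nat} (s : Defs.space n) : nat :=
  minn (minn s.1 (n.-1 - s.1)) (minn s.2 (n.-1 - s.2)).

Lemma card_ord_interval (n a b : nat) :
  #|[set i : 'I_n | (a <= i < b)%N]| = (minn b n - a)%N.
Proof.
rewrite -sum1_card big_mkcond /=.
under eq_bigr do rewrite inE.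
rewrite -(big_mkord xpredT (fun i => if (a <= i < b)%N then 1%N else 0%N)).
elim: n => [|n IH]; first by rewrite big_geq //; lia.
rewrite big_nat_recr //= IH; case: ifP => h; lia.
Qed.

Lemma sum_space {n : nat} (P : 'I_n -> 'I_n -> bool) :
  (\sum_(q : Defs.space n) P q.1 q.2 = \sum_(x < n) \sum_(y < n) P x y)%N.
Proof. by rewrite pair_bigA. Qed.

Lemma sum_ord_eq (n c : nat) : (\sum_(y < n) (c == y :> nat) = (c < n))%N.
Proof.
case: (ltnP c n) => h.
  rewrite (bigD1 (Ordinal h)) //= eqxx big1 // => y hy.
  by case: eqP => // e; case/eqP: hy; apply/val_inj.
by rewrite big1 // => y _; case: eqP => // e; have := ltn_ord y; lia.
Qed.

(** Each row [x] meets the diagonal in the single column [x + j - i]; the right side counts the rows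
    for which this column is on the board. The equation is written with sums to avoid truncated
    subtraction. *)
Lemma card_diagonal (n i j : nat) : (i < n)%N -> (j < n)%N ->
  (\sum_(q : Defs.space n) (q.1 + j == q.2 + i)
     = minn (n + i - j) n - (i - j))%N.
Proof.
move=> hi hj; rewrite (sum_space (fun x y => x + j == y + i)%N).
rewrite -card_ord_interval -sum1_card [RHS]big_mkcond /=.
apply: eq_bigr => x _; rewrite inE; have hx := ltn_ord x.
transitivity (\sum_(y < n) ((i <= x + j) && (x + j - i == y)))%N.
  apply: eq_bigr => y _; congr nat_of_bool.
  by move: (nat_of_ord x) (nat_of_ord y) => ? ?; lia.
case: (leqP i (x + j)) => h /=; last by rewrite big1_eq; case: ifP; lia.
by rewrite sum_ord_eq; case: ifP; lia.
Qed.

Lemma card_antidiagonal (n i j : nat) : (i < n)%N -> (j < n)%N ->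
  (\sum_(q : Defs.space n) (q.1 + q.2 == i + j)
     = minn (i + j).+1 n - ((i + j).+1 - n))%N.
Proof.
move=> hi hj; rewrite (sum_space (fun x y => x + y == i + j)%N).
rewrite -card_ord_interval -sum1_card [RHS]big_mkcond /=.
apply: eq_bigr => x _; rewrite inE; have hx := ltn_ord x.
transitivity (\sum_(y < n) ((x <= i + j) && (i + j - x == y)))%N.
  apply: eq_bigr => y _; congr nat_of_bool.
  by move: (nat_of_ord x) (nat_of_ord y) => ? ?; lia.
case: (leqP x (i + j)) => h /=; last by rewrite big1_eq; case: ifP; lia.
by rewrite sum_ord_eq; case: ifP; lia.
Qed.

(** With [i], [j] the coordinates of [s], the diagonals have [n - |i - j|] and
    [n - |i + j - (n - 1)|] spaces. Since [|a| + |b|] is the larger of [|a + b|] and [|a - b|],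
    together they have [n + 1 + 2d], where [d] is the edge distance. Row and column add [2n], and
    [s] is counted three times too often. *)
Lemma card_attackers (n : nat) (s : Defs.space n) :
  (#|[set q | queen_attacks q s]| + 2 = 3 * n + 2 * edge_distance s)%N.
Proof.
have hi := ltn_ord s.1; have hj := ltn_ord s.2.
have row : (\sum_(q : Defs.space n) ((s.1 : nat) == q.1) = n)%N.
  rewrite (sum_space (fun x y => (s.1 : nat) == x)) exchange_big /=.
  under eq_bigr do rewrite sum_ord_eq hi.
  by rewrite sum_nat_const card_ord muln1.
have col : (\sum_(q : Defs.space n) ((s.2 : nat) == q.2) = n)%N.
  rewrite (sum_space (fun x y => (s.2 : nat) == y)).
  under eq_bigr do rewrite sum_ord_eq hj.
  by rewrite sum_nat_const card_ord muln1.
have self : (\sum_(q : Defs.space n) (q == s) = 1)%N.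
  by rewrite (bigD1 s) //= eqxx big1 // => q /negbTE ->.
(* Any two of the four lines through s meet only in s. *)
have : (\sum_(q : Defs.space n) queen_attacks q s
   + 3 * \sum_(q : Defs.space n) (q == s)
  = \sum_(q : Defs.space n) ((s.1 : nat) == q.1)
  + \sum_(q : Defs.space n) ((s.2 : nat) == q.2)
  + \sum_(q : Defs.space n) (q.1 + s.2 == q.2 + s.1)
  + \sum_(q : Defs.space n) (q.1 + q.2 == s.1 + s.2))%N.
  rewrite big_distrr -!big_split /=; apply: eq_bigr => q _.
  have -> : (q == s) = ((q.1 : nat) == s.1) && ((q.2 : nat) == s.2).
    by case: q s {hi hj row col self} => ? ? [? ?].
  rewrite /queen_attacks -!val_eqE /=.
  move: (nat_of_ord q.1) (nat_of_ord q.2) (nat_of_ord s.1) (nat_of_ord s.2).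
  by move=> x y i j; lia.
rewrite self row col card_diagonal // card_antidiagonal //.
have -> : (\sum_(q : Defs.space n) queen_attacks q s)%N =
    #|[set q | queen_attacks q s]|.
  by rewrite -sum1_card [RHS]big_mkcond; apply: eq_bigr => q _; rewrite inE; case: ifP.
rewrite /edge_distance; move: #|_| => a.
move: (nat_of_ord s.1) (nat_of_ord s.2) hi hj => i j hi hj; lia.
Qed.

(** These spaces form a central square of side [n - 2d]; truncation makes it empty beyond the
    centre. *)
Lemma card_edge_distance_ge (n d : nat) :
  #|[set s : Defs.space n | (d <= edge_distance s)%N]| = ((n - 2 * d) ^ 2)%N.
Proof.
case: n => [|n].
  by apply/eqP; rewrite cards_eq0; apply/eqP/setP => -[[]].
have -> : [set s : Defs.space n.+1 | (d <= edge_distance s)%N] =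
  finset.setX [set i : 'I_n.+1 | (d <= i < n.+1 - d)%N] [set i : 'I_n.+1 | (d <= i < n.+1 - d)%N].
  apply/setP => -[i j]; rewrite !inE /edge_distance /=.
  by have := ltn_ord i; have := ltn_ord j; lia.
rewrite cardsX card_ord_interval mulnn; congr (_ ^ 2)%N; lia.
Qed.

(** * The expectation as a sum of binomial ratios, and exponential bounds on these *)

(** By linearity of expectation, it suffices to count for each [s] the [n]-subsets of the complement
    of its attackers. *)
Lemma expected_safeE (R : realType) (n : nat) :
  expected_safe R n =
  \sum_(s : Defs.space n) 'C(n ^ 2 - #|[set q | queen_attacks q s]|, n)%:R / 'C(n ^ 2, n)%:R.
Proof.
have cardT : #|[set: Defs.space n]| = (n ^ 2)%N by rewrite cardsT card_prod card_ord.
have cardD : #|configurations n| = 'C(n ^ 2, n).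
  rewrite -cardT -cards_draws; apply: eq_card => B.
  by rewrite !inE finset.subsetT.
rewrite /expected_safe /uniform_expectation cardD -mulr_suml; congr (_ / _).
rewrite -!natr_sum; congr (_%:R).
under eq_bigr do rewrite -sum1_card big_mkcond.
rewrite exchange_big /=; apply: eq_bigr => s _.
rewrite -big_mkcondr /= sum1_card.
have -> : (n ^ 2 - #|[set q | queen_attacks q s]| =
    #|~: [set q | queen_attacks q s]|)%N.
  by rewrite [RHS]cardsCs finset.setCK card_prod card_ord.
rewrite -cards_draws; apply: eq_card => B; rewrite !inE andbC; congr (_ && _).
  by rewrite inE.
rewrite inE; apply/andP/fintype.subsetP => [[_ /forallP hB] q qB|hB].
  by rewrite !inE; have := hB q; rewrite qB.
split.
  (* A queen on [s] would itself be an attacker of [s]. *)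
  by apply/negP => /hB; rewrite !inE /queen_attacks eqxx.
by apply/forallP => q; apply/implyP => /hB; rewrite !inE.
Qed.

(** Passing from [k] to [k + 1] multiplies the ratio by [(N - a - k) / (N - k)], which is at most
    [1 - a/N], hence at most [e^(-a/N)]. *)
Lemma binomial_ratio_le (R : realType) (N a k : nat) :
  'C(N - a, k)%:R <= 'C(N, k)%:R * expR (- (a * k)%:R / N%:R) :> R.
Proof.
elim: k => [|k IH]; first by rewrite !bin0 muln0 oppr0 mul0r expR0 mulr1.
have [kN|Nk] := ltnP k N; last first.
  by rewrite bin_small ?mulr_ge0 ?expR_ge0 //; lia.
have hk : (0 : R) < k.+1%:R by [].
rewrite -(ler_pM2l hk) mulrA -!natrM !mul_bin_left mulnSr.
have -> : expR (- (a * k + a)%:R / N%:R) =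
    expR (- (a * k)%:R / N%:R) * expR (- a%:R / N%:R) :> R.
  by rewrite -expRD natrD opprD mulrDl.
have step : (N - a - k)%:R <= (N - k)%:R * expR (- a%:R / N%:R) :> R.
  have [akN|] := leqP (a + k) N; last first.
    move=> h; have -> : (N - a - k = 0)%N by lia.
    by rewrite mulr_ge0 ?expR_ge0.
  apply: (@le_trans _ _ ((N - k)%:R * (1 - a%:R / N%:R))); last first.
    by rewrite ler_wpM2l // -mulNr; exact: expR_ge1Dx.
  have N0 : (0 : R) < N%:R by rewrite ltr0n; lia.
  rewrite -(ler_pM2r N0) -mulrA mulrBl mul1r divfK ?gt_eqF //.
  rewrite !natrB; [|lia..].
  have := ler0n R a; have := ler0n R k; nra.
rewrite (natrM _ (N - a - k)) (natrM _ (N - k)); apply: le_trans (ler_pM _ _ step IH) _ => //.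
by rewrite [in leRHS](mulrC (expR _)) mulrACA.
Qed.

(** The inverse factor is [1 + a / (N - a - k)]. As [k < n] at each step, it is at most [1 + a/M],
    hence at most [e^(a/M)], with [M = N - n - a]. *)
Lemma binomial_ratio_ge (R : realType) (N a n k : nat) :
  (a + n < N)%N -> (k <= n)%N ->
  'C(N, k)%:R * expR (- (a * k)%:R / (N - n - a)%:R) <= 'C(N - a, k)%:R :> R.
Proof.
move=> anN; elim: k => [|k IH] kn.
  by rewrite !bin0 muln0 oppr0 mul0r expR0 mulr1.
have hk : (0 : R) < k.+1%:R by [].
rewrite -(ler_pM2l hk) mulrA -!natrM !mul_bin_left mulnSr.
set M := (N - n - a)%N.
have -> : expR (- (a * k + a)%:R / M%:R) =
    expR (- (a * k)%:R / M%:R) * expR (- a%:R / M%:R) :> R.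
  by rewrite -expRD natrD opprD mulrDl.
have step : (N - k)%:R * expR (- a%:R / M%:R) <= (N - a - k)%:R :> R.
  have M0 : (0 : R) < M%:R by rewrite ltr0n /M; lia.
  rewrite mulNr expRN ler_pdivrMr ?expR_gt0 //.
  apply: (@le_trans _ _ ((N - a - k)%:R * (1 + a%:R / M%:R))); last first.
    by rewrite ler_wpM2l // expR_ge1Dx.
  have -> : (N - k = N - a - k + a)%N by lia.
  rewrite natrD mulrDr mulr1 lerD2l mulrA ler_pdivlMr // mulrC ler_wpM2r //.
  by rewrite ler_nat /M; lia.
rewrite (natrM _ (N - a - k)) (natrM _ (N - k)); apply: le_trans (ler_pM _ _ step (IH (ltnW kn))).
- by rewrite [in leLHS](mulrC (expR _)) mulrACA.
- by rewrite mulr_ge0 ?expR_ge0.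
- by rewrite mulr_ge0 ?expR_ge0.
Qed.

(** * The Riemann sum over the distance to the edge *)

Lemma sum_edge_distance (R : realType) (n : nat) (f : nat -> R) :
  \sum_(s : Defs.space n) f (edge_distance s) =
  \sum_(d < n) (((n - 2 * d) ^ 2)%:R - ((n - 2 * d.+1) ^ 2)%:R) * f d.
Proof.
have ltn_ed (s : Defs.space n) : (edge_distance s < n)%N.
  by rewrite /edge_distance; have := ltn_ord s.1; lia.
(* The indicator of distance exactly [d] is a difference of two threshold indicators, whose sums are
   the central squares. *)
transitivity (\sum_(s : Defs.space n) \sum_(d < n)
    ((d <= edge_distance s)%N%:R - (d.+1 <= edge_distance s)%N%:R) * f d).
  apply: eq_bigr => s _; rewrite (bigD1 (Ordinal (ltn_ed s))) //= big1.
    by rewrite leqnn ltnn subr0 mul1r addr0.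
  move=> d; rewrite -val_eqE /= => hd.
  have -> : (d < edge_distance s)%N = (d <= edge_distance s)%N by lia.
  by rewrite subrr mul0r.
rewrite exchange_big; apply: eq_bigr => d _; rewrite -mulr_suml; congr (_ * _).
by rewrite sumrB -!natr_sum -!card_edge_distance_ge; congr (_%:R - _%:R);
  rewrite -sum1_card [RHS]big_mkcond; apply: eq_bigr => s _; rewrite inE; case: ifP.
Qed.

(** The derivative [(1 - u) e^(-u)] of [u e^(-u)] decreases on [[0, 1]], so an increment lies
    between the step times its two end values. Two elementary bounds on [e^(-k)] replace
    calculus. *)
Lemma mulr_expRN_increment (R : realType) (u k : R) : 0 <= u -> 0 <= k -> u + k <= 1 ->
  k * (1 - (u + k)) * expR (- (u + k))
    <= (u + k) * expR (- (u + k)) - u * expR (- u) <= k * (1 - u) * expR (- u).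
Proof.
move=> u0 k0 uk1; rewrite opprD expRD.
have U0 := expR_gt0 (- u); have E1 := expR_ge1Dx (- k).
have E2 : expR (- k) * (1 + k) <= 1.
  by rewrite expRN mulrC ler_pdivrMr ?expR_gt0 // mul1r expR_ge1Dx.
have E0 := expR_gt0 (- k).
move: (expR (- u)) (expR (- k)) U0 E0 E1 E2 => U E U0 E0 E1 E2.
(* [lo] and [hi] are the two bounds divided by [e^(-u)]: the first comes from [E >= 1 - k], the
   second from [E * (1 + k) <= 1]. *)
have lo : u <= E * (u + k * u + k ^+ 2) by nra.
have hi : (u + k) * E <= u + k * (1 - u).
  rewrite -(@ler_pM2r _ (1 + k)); last lra.
  by nra.
apply/andP; split; nra.
Qed.

Lemma sum_expR_edge_distance (R : realType) (n : nat) : (0 < n)%N ->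
  2 * @expR R (- 1) - 4 / n%:R
    <= (\sum_(s : Defs.space n) @expR R (- (2 * (edge_distance s)%:R / n%:R)))
         / n%:R ^+ 2
    <= 2 * expR (- 1) + 4 / n%:R.
Proof.
move=> n0; have N0 : (0 : R) < n%:R by rewrite ltr0n.
pose h : R := 2 / n%:R; have h0 : 0 < h by rewrite divr_gt0.
(* With mesh [h], [v d] is [1 - h d] cut off at 0 by truncation. Thus [F] samples [u e^(-u)] at
   points capped at 1, and [t d] is the share of the average due to distance [d]. *)
pose v d : R := (n - 2 * d)%N%:R / n%:R.
pose F d := (1 - v d) * expR (- (1 - v d)).
pose t d := (v d ^+ 2 - v d.+1 ^+ 2) * expR (- (h * d%:R)).
have v0 d : 0 <= v d by rewrite divr_ge0.
have v1 d : v d <= 1 by rewrite ler_pdivrMr // mul1r ler_nat; lia.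
have vE d : 0 < v d -> 1 - v d = h * d%:R.
  rewrite pmulr_lgt0 ?invr_gt0 // ltr0n => hd.
  rewrite /v /h natrB ?natrM; last lia.
  by field; rewrite gt_eqF.
have vS d : v d.+1 <= v d.
  by rewrite ler_pM2r ?invr_gt0 // ler_nat; lia.
have vh d : v d - v d.+1 <= h.
  by rewrite -mulrBl ler_pM2r ?invr_gt0 // lerBlDr -natrD ler_nat; lia.
(* For odd [n] the last nonzero step is shorter than [h], hence the positivity condition. *)
have vSE d : 0 < v d.+1 -> v d - v d.+1 = h.
  move=> vd; have := vE _ vd; have := vE d (lt_le_trans vd (vS d)).
  by rewrite -natr1; lra.
have v00 : v 0%N = 1 by rewrite /v muln0 subn0 divff ?gt_eqF.
have incr d := @mulr_expRN_increment R (1 - v d) (v d - v d.+1).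
have FS d : (v d - v d.+1) * v d.+1 * expR (- (1 - v d.+1)) <= F d.+1 - F d
    <= (v d - v d.+1) * v d * expR (- (1 - v d)).
  have := incr d; rewrite !subr_ge0 => /(_ (v1 d) (vS d)).
  have -> : 1 - v d + (v d - v d.+1) = 1 - v d.+1 by ring.
  by rewrite !subKr; apply; rewrite gerBl.
(* Factor the difference of squares: [v d - v d.+1] is at most [h], and [v d + v d.+1] at most
   [2 * v d]. *)
have tle d : t d <= 2 * (h * v d * expR (- (1 - v d))).
  have := v0 d; rewrite le_eqVlt => /orP[/eqP vd|vd].
    have vd1 : v d.+1 = 0 by apply/eqP; rewrite eq_le v0 andbT vd vS.
    by rewrite /t -vd vd1 subrr !(mul0r, mulr0).
  rewrite /t -vE // [leRHS]mulrA ler_pM2r ?expR_gt0 //.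
  rewrite subr_sqr mulrCA ler_pM ?subr_ge0 ?addr_ge0 //.
  by rewrite mulrDl mul1r lerD2l.
have tge d : 2 * (h * v d.+1 * expR (- (1 - v d.+1))) <= t d.
  have := v0 d.+1; rewrite le_eqVlt => /orP[/eqP vd|vd].
    by rewrite -vd !(mul0r, mulr0) mulr_ge0 ?expR_ge0 // -vd expr0n subr0 sqr_ge0.
  apply: (@le_trans _ _ (2 * (h * v d.+1 * expR (- (h * d%:R))))).
    rewrite ler_pM2l // (ler_pM2l (mulr_gt0 h0 vd)) ler_expR vE // lerN2.
    by rewrite ler_pM2l // ler_nat.
  rewrite /t [leLHS]mulrA ler_pM2r ?expR_gt0 //.
  rewrite subr_sqr (vSE _ vd) mulrCA ler_pM2l //.
  by rewrite mulrDl mul1r lerD2r.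
have SE : (\sum_(s : Defs.space n) expR (- (2 * (edge_distance s)%:R / n%:R)))
    / n%:R ^+ 2 = \sum_(0 <= d < n) t d.
  rewrite (sum_edge_distance R n (fun d => expR (- (2 * d%:R / n%:R)))).
  rewrite mulr_suml big_mkord; apply: eq_bigr => d _.
  rewrite /t /v /h !expr_div_n -mulrBl -!natrX mulrAC [2 * _ / _]mulrAC.
  by [].
(* The term at 0 costs at most [2 * h]; each later one is at most twice the increment of [F] ending
   at its index. *)
have upper m : \sum_(0 <= d < m.+1) t d <= 2 * h + 2 * F m.
  elim: m => [|m IH].
    have := tle 0%N.
    by rewrite big_nat1 /F v00 subrr oppr0 expR0; lra.
  rewrite big_nat_recr //=.
  have := tle m.+1; have /andP[+ _] := FS m.
  have := v0 m.+1; rewrite le_eqVlt => /orP[/eqP <-|vm].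
    by rewrite !(mul0r, mulr0); lra.
  by rewrite (vSE _ vm); lra.
(* Here each term dominates twice the increment of [F] starting one index later; the missing first
   increment is at most [h]. *)
have lower m : 2 * (F m.+1 - F 1%N) <= \sum_(0 <= d < m) t d.
  elim: m => [|m IH]; first by rewrite big_geq // subrr mulr0.
  rewrite big_nat_recr //=.
  have := tge m; have /andP[_ FSm] := FS m.+1.
  have : (v m.+1 - v m.+2) * v m.+1 * expR (- (1 - v m.+1)) <=
     h * v m.+1 * expR (- (1 - v m.+1)).
    by rewrite ler_wpM2r ?expR_ge0 // ler_wpM2r.
  lra.
rewrite /= SE; apply/andP; split.
  apply: le_trans (lower n).
  have -> : F n.+1 = expR (- 1).
    by rewrite /F /v (_ : n - _ = 0)%N ?mul0r ?subr0 ?mul1r //; lia.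
  have : F 1%N <= h.
    apply: (@le_trans _ _ (1 - v 1%N)); last by have := vh 0%N; rewrite v00.
    rewrite ler_piMr ?subr_ge0 // -[leRHS]expR0 ler_expR oppr_le0 subr_ge0.
    by [].
  rewrite /h; lra.
have := upper n.-1; rewrite prednK // => /le_trans; apply.
(* The increment from [1 - v n.-1] to 1 is nonnegative, so [F n.-1] is at most [e^(-1)]. *)
have := @mulr_expRN_increment R (1 - v n.-1) (v n.-1).
rewrite subrK subrr mulr0 mul0r mul1r subr_ge0 => /(_ (v1 _) (v0 _) (lexx _)).
by case/andP => + _; rewrite -/(F n.-1) /h; lra.
Qed.

(** * Uniform bounds on the safety probability, and the limit *)

Lemma safe_probability_bounds (R : realType) (n : nat) (s : Defs.space n) :
  (10 <= n)%N ->
  @expR R (- (40 * n%:R^-1)) *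
      (expR (- 3 + 2 * n%:R^-1) * expR (- (2 * (edge_distance s)%:R / n%:R)))
    <= 'C(n ^ 2 - #|[set q | queen_attacks q s]|, n)%:R / 'C(n ^ 2, n)%:R
    <= expR (- 3 + 2 * n%:R^-1) * @expR R (- (2 * (edge_distance s)%:R / n%:R)).
Proof.
move=> n10.
have N0 : (0 : R) < n%:R by rewrite ltr0n; lia.
have N10 : (10 : R) <= n%:R by rewrite (ler_nat _ 10).
have C0 : (0 : R) < 'C(n ^ 2, n)%:R by rewrite ltr0n bin_gt0; nia.
have aE := card_attackers n s.
have ed : (2 * edge_distance s <= n)%N.
  by rewrite /edge_distance; have := ltn_ord s.1; lia.
move: #|_| (edge_distance s) aE ed => a d aE ed.
have aR : a%:R = 3 * n%:R - 2 + 2 * d%:R :> R.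
  by apply/eqP; rewrite addrAC eq_sym subr_eq -!natrM -!natrD -aE.
rewrite -expRD.
have -> : - 3 + 2 * n%:R^-1 + - (2 * d%:R / n%:R) = - a%:R / n%:R :> R.
  by rewrite aR; field; rewrite gt_eqF.
rewrite ler_pdivlMr // ler_pdivrMr //; apply/andP; split; last first.
  have := @binomial_ratio_le R (n ^ 2) a n.
  rewrite [leRHS]mulrC natrM natrX.
  by have -> : - (a%:R * n%:R) / n%:R ^+ 2 = - a%:R / n%:R :> R
    by field; rewrite gt_eqF.
have an : (a + n < n ^ 2)%N by nia.
have := binomial_ratio_ge R _ _ _ _ an (leqnn n); apply: le_trans.
rewrite mulrC ler_pM2l // -expRD ler_expR natrM.
have an2 : (n ^ 2 - n - a)%:R = n%:R ^+ 2 - n%:R - a%:R :> R.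
  by rewrite !natrB ?natrX //; nia.
rewrite an2.
(* The two exponents differ by [a (n + a) / (n (n^2 - n - a))]. With [a <= 4n] this is at most
   [20 / (n - 5)], hence at most [40 / n] once [n >= 10]. *)
have a4 : a%:R <= 4 * n%:R :> R by rewrite -natrM ler_nat; lia.
have M0 : 0 < n%:R ^+ 2 - n%:R - a%:R :> R by nra.
have a0 := ler0n R a.
move: (a%:R : R) (n%:R : R) N0 N10 a4 M0 a0 => x y N0 N10 a4 M0 x0.
rewrite mulNr -opprD mulNr lerN2 -mulrDl ler_pdivlMr // mulrAC ler_pdivrMr //.
nra.
Qed.

Lemma mean_safe_proportion_bounds (R : realType) (n : nat) : (10 <= n)%N ->
  @expR R (- (40 * n%:R^-1)) * (expR (- 3 + 2 * n%:R^-1) * (2 * expR (- 1) - 4 * n%:R^-1))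
    <= mean_safe_proportion R n
    <= expR (- 3 + 2 * n%:R^-1) * (2 * expR (- 1) + 4 * n%:R^-1).
Proof.
move=> n10; have N2 : 0 < (n%:R : R) ^+ 2 by rewrite exprn_gt0 // ltr0n; lia.
have /andP[lo hi] := sum_expR_edge_distance R n (leq_trans (isT : (0 < 10)%N) n10).
rewrite /mean_safe_proportion expected_safeE; apply/andP; split.
  apply: le_trans (_ : expR (- (40 * n%:R^-1)) * (expR (- 3 + 2 * n%:R^-1) * (_ / _)) <= _).
    by rewrite ler_pM2l ?expR_gt0 // ler_pM2l ?expR_gt0 //; exact: lo.
  rewrite !mulrA ler_pM2r ?invr_gt0 // -mulrA !mulr_sumr; apply: ler_sum => s _.
  by have /andP[] := safe_probability_bounds R n s n10.
apply: le_trans (_ : expR (- 3 + 2 * n%:R^-1) * (_ / _) <= _); last first.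
  by rewrite ler_pM2l ?expR_gt0 //; exact: hi.
rewrite mulrA ler_pM2r ?invr_gt0 // mulr_sumr; apply: ler_sum => s _.
by have /andP[] := safe_probability_bounds R n s n10.
Qed.

Local Open Scope classical_set_scope.

Lemma cvg_mean_safe_proportion (R : realType) :
  mean_safe_proportion R n @[n --> \oo] --> (2 / expR 4 : R).
Proof.
have inv0 : (n%:R^-1 : R) @[n --> \oo] --> (0 : R).
  (* The harmonic sequence is [1 / (n + 1)], hence the shift. *)
  by rewrite -(cvg_shiftS (fun n => n%:R^-1 : R)); exact: cvg_harmonic.
have cexp (c k : R) : expR (c + k * n%:R^-1) @[n --> \oo] --> expR c.
  apply: continuous_cvg; first exact: continuous_expR.
  rewrite -[X in _ --> X]addr0 -[X in _ + X](mulr0 k).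
  by apply: cvgD; [exact: cvg_cst|apply: cvgM; [exact: cvg_cst|]].
have lim : 2 / expR 4 = expR (- 3) * (2 * expR (- 1)) :> R.
  rewrite mulrCA -expRD -expRN; congr (_ * expR _); ring.
have ccst (k : R) : 2 * expR (- 1) + k * n%:R^-1 @[n --> \oo] --> 2 * expR (- 1).
  rewrite -[X in _ --> X]addr0 -[X in _ + X](mulr0 k).
  by apply: cvgD; [exact: cvg_cst|apply: cvgM; [exact: cvg_cst|]].
apply: squeeze_cvgr.
- by near=> n; apply: mean_safe_proportion_bounds; near: n; exact: nbhs_infty_ge.
- have -> : 2 / expR 4 = expR 0 * (expR (- 3) * (2 * expR (- 1))) :> R.
    by rewrite expR0 mul1r.
  apply: cvgM; last apply: cvgM.
  + by under eq_fun do rewrite -[X in expR X]add0r -mulNr; exact: cexp.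
  + exact: cexp.
  + by under eq_fun do rewrite -mulNr; exact: ccst.
- by rewrite lim; apply: cvgM; [exact: cexp|exact: ccst].
Unshelve. all: by end_near. Qed.

Theorem theorem1p3 (R : realType) :
  ((expected_safe R : nat -> R^o) ~_\oo
     (fun n : nat => 2 * n%:R ^+ 2 / expR 4 : R^o))
  /\ (mean_safe_proportion R n @[n --> \oo] --> (2 / expR 4 : R)).
Proof.
have cvg := cvg_mean_safe_proportion R; split=> //.
apply/eqaddoP => eps eps0.
have c0 : 0 < 2 / expR 4 :> R by rewrite divr_gt0 ?expR_gt0.
(* A tolerance of [eps] times the limit, multiplied by [n^2], is the relative error [eps] that the
   equivalence asks for. *)
have /cvgrPdist_le/(_ _ (mulr_gt0 eps0 c0)) := cvg.
apply: filterS2 (nbhs_infty_gt 0) => n n0 h.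
have N2 : 0 < (n%:R : R) ^+ 2 by rewrite exprn_gt0 // ltr0n.
have -> : ((expected_safe R : nat -> R^o) - (fun n : nat => 2 * n%:R ^+ 2 / expR 4 : R^o)) n
  = (mean_safe_proportion R n - 2 / expR 4) * n%:R ^+ 2.
  rewrite /mean_safe_proportion mulrBl divfK ?gt_eqF //.
  by rewrite [2 / _ * _]mulrAC.
rewrite /= [2 * _ / _]mulrAC !(normrM _ (n%:R ^+ 2)) distrC (gtr0_norm c0) mulrA.
by rewrite ler_wpM2r.
Qed.
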